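(* There exists a connected metric space $X$ which admits a Lipschitz co-mixer and whose fundamental group satisfies $\pi_1(X)\cong\mathbb Z/(2\mathbb Z)$.
   Context: A co-mixer on a metric space $X$ is a continuous map $\tau\colon X^3\to X$ such that $\tau(a,a,b)=\tau(a,b,a)=\tau(b,a,a)=b$ for all $a,b\in X$. It is called Lipschitz if it is Lipschitz as a map from $X^3$ (with, e.g., the maximum or sum product metric) to $X$; equivalently, there is a constant $L$ such that $\tau$ is $L$-Lipschitz in each of its three variables separately (for all fixed values of the other two). The basepoint is suppressed in the notation $\pi_1(X)$: the isomorphism is understood to hold for every basepoint. *)

(* Defs.v *)
From HB Require Import structures.
From mathcomp Require Import all_boot all_order all_algebra all_fingroup.
From mathcomp Require Import generic_quotient.
From mathcomp Require Import all_classical all_reals all_analysis.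
From mathcomp Require Import homotopy lra.

Set Implicit Arguments.
Unset Strict Implicit.
Unset Printing Implicit Defensive.

Import Order.TTheory GRing.Theory Num.Theory.
Import numFieldNormedType.Exports.

Local Open Scope classical_set_scope.
Local Open Scope ring_scope.
Local Open Scope quotient_scope.

Definition unit_interval (R : realType) : Type := set_type `[0 : R, 1 : R].

Section unit_interval.
Context {R : realType}.
Local Notation I := (unit_interval R).

HB.instance Definition _ := Topological.copy I (set_type `[0 : R, 1 : R]).

Definition uval (t : I) : R := \val t.

Lemma uval_inj : injective uval.
Proof. exact: val_inj. Qed.

Lemma unit_interval_itv (t : I) : 0 <= uval t <= 1.
Proof. by have := set_valP t; rewrite /= in_itv. Qed.

Let clamp_proof (x : R) : Num.max 0 (Num.min x 1) \in `[0 : R, 1 : R]%classic.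
Proof.
by apply/mem_set; rewrite /= in_itv/= le_max lexx/= ge_max ler01 ge_min lexx orbT.
Qed.

(* The retraction of the real line onto [0, 1]. *)
Definition clamp (x : R) : I :=
  exist (fun y => y \in `[0 : R, 1 : R]%classic) _ (clamp_proof x).

Lemma val_clamp x : uval (clamp x) = Num.max 0 (Num.min x 1).
Proof. by []. Qed.

Lemma clampE x : 0 <= x <= 1 -> uval (clamp x) = x.
Proof. by case/andP => x0 x1; rewrite val_clamp (min_l x1) (max_r x0). Qed.

Lemma clampK (t : I) : clamp (uval t) = t.
Proof. exact/uval_inj/clampE/unit_interval_itv. Qed.

Lemma zero_one_unit_interval : clamp 0 != clamp 1.
Proof.
by apply/eqP => /(congr1 uval); rewrite !clampE ?lexx ?ler01// => /eqP;
   rewrite eq_sym oner_eq0.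
Qed.

HB.instance Definition _ := isBiPointed.Build I zero_one_unit_interval.

Lemma val_zero : uval (zero : I) = 0 :> R.
Proof. by rewrite clampE// lexx ler01. Qed.

Lemma val_one : uval (one : I) = 1 :> R.
Proof. by rewrite clampE// lexx ler01. Qed.

Lemma val_continuous : continuous uval.
Proof. exact: initial_continuous. Qed.

Lemma fun_add_continuous (S : topologicalType) (f g : S -> R) :
  continuous f -> continuous g -> continuous (fun s => f s + g s).
Proof. by move=> cf cg s; apply: continuousD; [exact: cf|exact: cg]. Qed.

Lemma fun_opp_continuous (S : topologicalType) (f : S -> R) :
  continuous f -> continuous (fun s => - f s).
Proof. by move=> cf s; apply: continuousN; exact: cf. Qed.

Lemma fun_mul_continuous (S : topologicalType) (f g : S -> R) :
  continuous f -> continuous g -> continuous (fun s => f s * g s).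
Proof. by move=> cf cg s; apply: continuousM; [exact: cf|exact: cg]. Qed.

Lemma fun_max_continuous (S : topologicalType) (f g : S -> R) :
  continuous f -> continuous g -> continuous (fun s => Num.max (f s) (g s)).
Proof.
move=> cf cg s; apply: (@continuous_max _ _ f g); [exact: cf|exact: cg].
Qed.

Lemma fun_min_continuous (S : topologicalType) (f g : S -> R) :
  continuous f -> continuous g -> continuous (fun s => Num.min (f s) (g s)).
Proof.
move=> cf cg s; apply: (@continuous_min _ _ f g); [exact: cf|exact: cg].
Qed.

Lemma clamp_continuous : continuous (clamp : R -> I).
Proof.
apply: continuous_comp_initial; apply: fun_max_continuous.
  by move=> x; exact: cst_continuous.
by apply: fun_min_continuous; [move=> x; exact: id|move=> x; exact: cst_continuous].
Qed.

Lemma glue_continuous (S T : topologicalType) (c : S -> R) (a : R)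
    (f g : S -> T) : continuous c -> continuous f -> continuous g ->
  (forall s, c s = a -> f s = g s) ->
  continuous (fun s => if c s <= a then f s else g s).
Proof.
move=> cc cf cg fg x U /=.
have [cxa|acx|cxa] := ltgtP (c x) a => Ux.
- have near_a : \forall s \near x, c s < a by exact: cvgr_lt (cc x) _ cxa.
  move: near_a (cf x U Ux); apply: filterS2 => s /=.
  by move=> /ltW ->.
- have near_a : \forall s \near x, a < c s by exact: cvgr_gt (cc x) _ acx.
  move: near_a (cg x U Ux); apply: filterS2 => s /=.
  by rewrite ltNge => /negbTE ->.
- have Ux' : nbhs (g x) U by rewrite -fg.
  have Uf : \forall s \near x, U (f s) by exact: cf x U Ux.
  have Ug : \forall s \near x, U (g s) by exact: cg x U Ux'.
  move: Uf Ug; apply: filterS2 => s /=.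
  by case: ifP.
Qed.

End unit_interval.

Lemma comp_continuous (S T U : topologicalType) (f : S -> T) (g : T -> U) :
  continuous f -> continuous g -> continuous (fun s => g (f s)).
Proof. by move=> cf cg s; apply: continuous_comp; [exact: cf|exact: cg]. Qed.

Lemma pair_continuous (S T U : topologicalType) (f : S -> T) (g : S -> U) :
  continuous f -> continuous g -> continuous (fun s => (f s, g s)).
Proof. by move=> cf cg s; apply: cvg_pair; [exact: cf|exact: cg]. Qed.

Lemma fun_cst_continuous (S T : topologicalType) (x : T) :
  continuous (fun _ : S => x).
Proof. by move=> s; exact: cst_continuous. Qed.

Lemma fun_fst_continuous (S T : topologicalType) :
  continuous (fun s : S * T => s.1).
Proof. by move=> s; exact: cvg_fst. Qed.

Lemma fun_snd_continuous (S T : topologicalType) :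
  continuous (fun s : S * T => s.2).
Proof. by move=> s; exact: cvg_snd. Qed.

Lemma fun_id_continuous (S : topologicalType) : continuous (fun s : S => s).
Proof. by move=> s; exact. Qed.

Ltac cts := repeat
  match goal with
  | H : continuous ?p |- continuous ?p => exact: H
  | |- continuous fst => exact: fun_fst_continuous
  | |- continuous snd => exact: fun_snd_continuous
  | |- continuous uval => exact: val_continuous
  | |- continuous clamp => exact: clamp_continuous
  | |- continuous (fun s => s) => exact: fun_id_continuous
  | |- continuous (fun s => s.1) => exact: fun_fst_continuous
  | |- continuous (fun s => s.2) => exact: fun_snd_continuous
  | |- continuous (fun s => ?x) => exact: fun_cst_continuous
  | |- continuous (fun s => (_, _)) => apply: pair_continuous
  | |- continuous (fun s => _ + _) => apply: fun_add_continuous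
  | |- continuous (fun s => - _) => apply: fun_opp_continuous
  | |- continuous (fun s => _ * _) => apply: fun_mul_continuous
  | |- continuous (fun s => Num.max _ _) => apply: fun_max_continuous
  | |- continuous (fun s => Num.min _ _) => apply: fun_min_continuous
  | |- continuous (fun s => clamp _) =>
      apply: (comp_continuous _ clamp_continuous)
  | |- continuous (fun s => uval _) =>
      apply: (comp_continuous _ val_continuous)
  | H : continuous ?p |- continuous (fun s => ?p _) =>
      apply: (comp_continuous _ H)
  end.

Section homotopy.
Context {R : realType} {T : topologicalType}.
Local Notation I := (unit_interval R).
Implicit Types x y z : T.

Definition concat_fun (p q : I -> T) (t : I) : T :=
  if uval t <= 2^-1 then p (clamp (2 * uval t)) else q (clamp (2 * uval t - 1)).

Lemma concat_continuous (p q : I -> T) : continuous p -> continuous q ->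
  p one = q zero -> continuous (concat_fun p q).
Proof.
move=> cp cq pq; apply: (glue_continuous (c := @uval R)); first by cts.
- by cts.
- by cts.
- by move=> t ->; rewrite divff ?pnatr_eq0// subrr.
Qed.

Let one_gt_half : (1 <= 2^-1 :> R) = false.
Proof. by apply/negbTE; rewrite -ltNge; lra. Qed.

Lemma concat_zero (p q : I -> T) : concat_fun p q zero = p zero.
Proof. by rewrite /concat_fun val_zero invr_ge0 ler0n mulr0. Qed.

Lemma concat_one (p q : I -> T) : concat_fun p q one = q one.
Proof.
rewrite /concat_fun val_one; rewrite one_gt_half.
by congr q; congr clamp; lra.
Qed.

Section concat.
Context {x y z : T}.
Variables (p : {path I from x to y in T}) (q : {path I from y to z in T}).

Let concat_cts : continuous (concat_fun p q).
Proof. by apply: concat_continuous; [exact: cts_fun..|rewrite path_one path_zero]. Qed.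

Let concat_zero' : concat_fun p q zero = x.
Proof. by rewrite concat_zero path_zero. Qed.

Let concat_one' : concat_fun p q one = z.
Proof. by rewrite concat_one path_one. Qed.

Definition path_concat : {path I from x to z in T} :=
  mk_path concat_cts concat_zero' concat_one'.

Lemma path_concatE t : path_concat t = concat_fun p q t.
Proof. by []. Qed.

End concat.

Section reverse.
Context {x y : T}.
Variable p : {path I from x to y in T}.

Definition reverse_fun (t : I) : T := p (clamp (1 - uval t)).

Let reverse_cts : continuous reverse_fun.
Proof. by have cp : continuous p := @cts_fun _ _ p; rewrite /reverse_fun; cts. Qed.

Let reverse_zero : reverse_fun zero = y.
Proof. by rewrite /reverse_fun val_zero subr0 path_one. Qed.

Let reverse_one : reverse_fun one = x.
Proof. by rewrite /reverse_fun val_one subrr path_zero. Qed.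

Definition path_reverse : {path I from y to x in T} :=
  mk_path reverse_cts reverse_zero reverse_one.

End reverse.

Definition path_cst x : {path I from x to x in T} := cst x.

(* Homotopy relative to the endpoints; the first variable of H is the
   deformation parameter. *)
Definition path_homotopic x y (p q : {path I from x to y in T}) : Prop :=
  exists H : I * I -> T, [/\ continuous H,
    forall t, H (zero, t) = p t, forall t, H (one, t) = q t,
    forall s, H (s, zero) = x & forall s, H (s, one) = y].

Lemma path_homotopic_reparam x y x' y' (p : {path I from x to y in T})
    (q r : {path I from x' to y' in T}) (f g : I -> R) :
  continuous f -> continuous g -> f zero = g zero -> f one = g one ->
  (forall t, q t = p (clamp (f t))) -> (forall t, r t = p (clamp (g t))) ->
  path_homotopic q r.
Proof.
move=> cf cg fg0 fg1 qE rE.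
have cp : continuous p := @cts_fun _ _ p.
exists (fun st => p (clamp ((1 - uval st.1) * f st.2 + uval st.1 * g st.2))).
split => [|t|t|s|s] /=.
- by cts.
- by rewrite qE val_zero subr0 mul1r mul0r addr0.
- by rewrite rE val_one subrr mul1r mul0r add0r.
- by rewrite fg0 -mulrDl subrK mul1r -rE path_zero.
- by rewrite fg1 -mulrDl subrK mul1r -rE path_one.
Qed.

Lemma path_homotopic_refl x y (p : {path I from x to y in T}) :
  path_homotopic p p.
Proof.
by apply: (path_homotopic_reparam (p := p) (f := uval) (g := uval)); cts => // t;
  rewrite clampK.
Qed.

Lemma path_homotopic_sym x y (p q : {path I from x to y in T}) :
  path_homotopic p q -> path_homotopic q p.
Proof.
move=> [H [cH H0 H1 Hx Hy]]; exists (fun st => H (clamp (1 - uval st.1), st.2)).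
split => [|t|t|s|s] //=.
- by cts.
- by rewrite val_zero subr0 H1.
- by rewrite val_one subrr H0.
Qed.

Lemma path_homotopic_trans x y (p q r : {path I from x to y in T}) :
  path_homotopic p q -> path_homotopic q r -> path_homotopic p r.
Proof.
move=> [H [cH H0 H1 Hx Hy]] [K [cK K0 K1 Kx Ky]].
exists (fun st => if uval st.1 <= 2^-1 then H (clamp (2 * uval st.1), st.2)
                  else K (clamp (2 * uval st.1 - 1), st.2)).
split => [|t|t|s|s] /=.
- apply: (glue_continuous (c := fun st : I * I => uval st.1)); first by cts.
  + by cts.
  + by cts.
  + by move=> [s t] /= ->; rewrite divff ?pnatr_eq0// subrr H1 K0.
- by rewrite val_zero invr_ge0 ler0n mulr0 H0.
- rewrite val_one; rewrite one_gt_half.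
  by rewrite (_ : 2 * 1 - 1 = 1)// ?K1//; lra.
- by case: ifP.
- by case: ifP.
Qed.

Lemma path_homotopic_concat x y z (p p' : {path I from x to y in T})
    (q q' : {path I from y to z in T}) :
  path_homotopic p p' -> path_homotopic q q' ->
  path_homotopic (path_concat p q) (path_concat p' q').
Proof.
move=> [H [cH H0 H1 Hx Hy]] [K [cK K0 K1 Kx Ky]].
exists (fun st => if uval st.2 <= 2^-1 then H (st.1, clamp (2 * uval st.2))
                  else K (st.1, clamp (2 * uval st.2 - 1))).
split => [|t|t|s|s] /=.
- apply: (glue_continuous (c := fun st : I * I => uval st.2)); first by cts.
  + by cts.
  + by cts.
  + by move=> [s t] /= ->; rewrite divff ?pnatr_eq0// subrr Hy Kx.
- by rewrite H0 K0.
- by rewrite H1 K1.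
- by rewrite val_zero invr_ge0 ler0n mulr0 Hx.
- rewrite val_one; rewrite one_gt_half.
  by rewrite (_ : 2 * 1 - 1 = 1)// ?Ky//; lra.
Qed.

Lemma path_homotopic_reverse x y (p q : {path I from x to y in T}) :
  path_homotopic p q -> path_homotopic (path_reverse p) (path_reverse q).
Proof.
move=> [H [cH H0 H1 Hx Hy]]; exists (fun st => H (st.1, clamp (1 - uval st.2))).
split => [|t|t|s|s] //=.
- by cts.
- by rewrite H0.
- by rewrite H1.
- by rewrite val_zero subr0 Hy.
- by rewrite val_one subrr Hx.
Qed.

Lemma path_concat_cstr x y (p : {path I from x to y in T}) :
  path_homotopic (path_concat p (path_cst y)) p.
Proof.
apply: (path_homotopic_reparam (p := p)
  (f := fun t => Num.min (2 * uval t) 1) (g := uval)); try by cts.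
- by rewrite val_zero mulr0 min_l.
- by rewrite val_one mulr1 min_r// ler1n.
- move=> t; rewrite /= /mk_path /concat_fun; case: ifPn => th.
    by rewrite min_l//; lra.
  by rewrite min_r ?path_one//; lra.
- by move=> t; rewrite clampK.
Qed.

Lemma path_concat_cstl x y (p : {path I from x to y in T}) :
  path_homotopic (path_concat (path_cst x) p) p.
Proof.
apply: (path_homotopic_reparam (p := p)
  (f := fun t => Num.max 0 (2 * uval t - 1)) (g := uval)); try by cts.
- by rewrite val_zero mulr0 max_l//; lra.
- by rewrite val_one max_r//; lra.
- move=> t; rewrite /= /mk_path /concat_fun; case: ifPn => th.
    by rewrite max_l ?path_zero//; lra.
  by rewrite max_r//; lra.
- by move=> t; rewrite clampK.
Qed.

Lemma path_concatV x y (p : {path I from x to y in T}) :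
  path_homotopic (path_concat p (path_reverse p)) (path_cst x).
Proof.
apply: (path_homotopic_reparam (p := p)
  (f := fun t => Num.min (2 * uval t) (2 - 2 * uval t)) (g := fun=> 0));
  try by cts.
- by rewrite val_zero min_l; lra.
- by rewrite val_one min_r; lra.
- move=> t; rewrite /= /mk_path /concat_fun; case: ifPn => th.
    by rewrite min_l//; lra.
  have /andP[t0 t1] := unit_interval_itv t.
  rewrite /= /mk_path /reverse_fun clampE; last by apply/andP; split; lra.
  by rewrite min_r; [congr (p (clamp _))|]; lra.
- by move=> t; rewrite path_zero.
Qed.

Lemma path_concatVl x y (p : {path I from x to y in T}) :
  path_homotopic (path_concat (path_reverse p) p) (path_cst y).
Proof.
apply: (path_homotopic_reparam (p := p)
  (f := fun t => Num.max (1 - 2 * uval t) (2 * uval t - 1)) (g := fun=> 1));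
  try by cts.
- by rewrite val_zero max_l; lra.
- by rewrite val_one max_r; lra.
- move=> t; rewrite /= /mk_path /concat_fun; case: ifPn => th; last first.
    by rewrite max_r//; lra.
  have /andP[t0 t1] := unit_interval_itv t.
  rewrite /= /mk_path /reverse_fun clampE; last by apply/andP; split; lra.
  by rewrite max_l//; lra.
- by move=> t; rewrite path_one.
Qed.

Lemma path_concatA x y z w (p : {path I from x to y in T})
    (q : {path I from y to z in T}) (r : {path I from z to w in T}) :
  path_homotopic (path_concat p (path_concat q r))
                 (path_concat (path_concat p q) r).
Proof.
apply: (path_homotopic_reparam (p := path_concat (path_concat p q) r)
  (f := fun t => Num.max (2^-1 * uval t)
                   (Num.max (uval t - 4^-1) (2 * uval t - 1)))
  (g := uval)); try by cts.
- by rewrite val_zero max_l ?ge_max; lra.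
- by rewrite val_one max_r; [rewrite max_r|rewrite le_max]; lra.
- move=> t; have /andP[t0 t1] := unit_interval_itv t.
  rewrite !path_concatE /concat_fun; case: ifPn => th.
    rewrite max_l; last by rewrite ge_max; apply/andP; split; lra.
    rewrite clampE; last by apply/andP; split; lra.
    rewrite ifT; last by lra.
    rewrite path_concatE /concat_fun clampE; last by apply/andP; split; lra.
    rewrite ifT; last by lra.
    by congr (p (clamp _)); lra.
  rewrite max_r; last by rewrite le_max; apply/orP; left; lra.
  rewrite path_concatE /concat_fun clampE; last by apply/andP; split; lra.
  case: ifPn => th2.
    rewrite max_l; last by lra.
    rewrite clampE; last by apply/andP; split; lra.
    rewrite ifT; last by lra.
    rewrite path_concatE /concat_fun clampE; last by apply/andP; split; lra.
    rewrite ifF; last by apply/negbTE; rewrite -ltNge; lra.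
    by congr (q (clamp _)); lra.
  rewrite max_r; last by lra.
  rewrite clampE; last by apply/andP; split; lra.
  rewrite ifF; last by apply/negbTE; rewrite -ltNge; lra.
  by congr (r (clamp _)); lra.
- by move=> t; rewrite clampK.
Qed.

End homotopy.

Section fundamental_group.
Context (R : realType) (T : topologicalType) (x : T).
Local Notation loop := {path (unit_interval R) from x to x in T}.

Definition loop_rel (p q : loop) : bool := `[< path_homotopic p q >].

Let loop_rel_refl : reflexive loop_rel.
Proof. by move=> p; apply/asboolP; exact: path_homotopic_refl. Qed.

Let loop_rel_sym : symmetric loop_rel.
Proof. by move=> p q; apply/asboolP/asboolP; exact: path_homotopic_sym. Qed.

Let loop_rel_trans : transitive loop_rel.
Proof.
move=> q p r /asboolP pq /asboolP qr; apply/asboolP.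
exact: path_homotopic_trans pq qr.
Qed.

Canonical loop_equiv := EquivRel loop_rel loop_rel_refl loop_rel_sym loop_rel_trans.

Definition pi1 : Type := {eq_quot loop_equiv}.
HB.instance Definition _ := Choice.on pi1.
HB.instance Definition _ := EqQuotient.on pi1.

Definition pi1_class (p : loop) : pi1 := \pi p.

Lemma pi1_classP (p q : loop) : pi1_class p = pi1_class q <-> path_homotopic p q.
Proof.
split=> [/eqmodP/asboolP//|pq]; apply/eqmodP/asboolP; exact: pq.
Qed.

Lemma repr_pi1_class (p : loop) : path_homotopic (repr (pi1_class p)) p.
Proof. by apply/pi1_classP; rewrite /pi1_class reprK. Qed.

Lemma pi1_classK (a : pi1) : pi1_class (repr a) = a.
Proof. exact: reprK. Qed.

Definition pi1_mul (a b : pi1) : pi1 := pi1_class (path_concat (repr a) (repr b)).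
Definition pi1_one : pi1 := pi1_class (path_cst x).
Definition pi1_inv (a : pi1) : pi1 := pi1_class (path_reverse (repr a)).

Lemma pi1_mulE (p q : loop) :
  pi1_mul (pi1_class p) (pi1_class q) = pi1_class (path_concat p q).
Proof. by apply/pi1_classP/path_homotopic_concat; exact: repr_pi1_class. Qed.

Lemma pi1_invE (p : loop) :
  pi1_inv (pi1_class p) = pi1_class (path_reverse p).
Proof. by apply/pi1_classP/path_homotopic_reverse; exact: repr_pi1_class. Qed.

Let pi1_mulA : associative pi1_mul.
Proof.
move=> a b c; rewrite -[a]pi1_classK -[b]pi1_classK -[c]pi1_classK !pi1_mulE.
by apply/pi1_classP; exact: path_concatA.
Qed.

Let pi1_mul1 : left_id pi1_one pi1_mul.
Proof.
move=> a; rewrite -[a]pi1_classK pi1_mulE.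
by apply/pi1_classP; exact: path_concat_cstl.
Qed.

Let pi1_mulr1 : right_id pi1_one pi1_mul.
Proof.
move=> a; rewrite -[a]pi1_classK pi1_mulE.
by apply/pi1_classP; exact: path_concat_cstr.
Qed.

Let pi1_mulV : left_inverse pi1_one pi1_inv pi1_mul.
Proof.
move=> a; rewrite -[a]pi1_classK pi1_invE pi1_mulE.
by apply/pi1_classP; exact: path_concatVl.
Qed.

Let pi1_mulrV : right_inverse pi1_one pi1_inv pi1_mul.
Proof.
move=> a; rewrite -[a]pi1_classK pi1_invE pi1_mulE.
by apply/pi1_classP; exact: path_concatV.
Qed.

HB.instance Definition _ :=
  isGroup.Build pi1 pi1_mulA pi1_mul1 pi1_mulr1 pi1_mulV pi1_mulrV.

Lemma pi1_mulgE (p q : loop) :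
  (pi1_class p * pi1_class q)%g = pi1_class (path_concat p q).
Proof. exact: pi1_mulE. Qed.

End fundamental_group.

Definition group_isomorphic (G H : groupType) : Prop :=
  exists f : G -> H, bijective f /\ {morph f : a b / (a * b)%g}.

(* As a group, 'Z_2 carries the addition modulo 2. *)
Lemma Z2_mulgE (a b : 'Z_2) : (a * b)%g = a + b.
Proof. by []. Qed.

Section comixer.
Context {R : realType} {X : metricType R}.
Implicit Types (tau : X * X * X -> X) (p q : X * X * X).

Definition max_dist3 p q : R :=
  Num.max (mdist p.1.1 q.1.1) (Num.max (mdist p.1.2 q.1.2) (mdist p.2 q.2)).

Definition is_comixer tau : Prop :=
  continuous tau /\
  forall a b, [/\ tau (a, a, b) = b, tau (a, b, a) = b & tau (b, a, a) = b].

Definition is_lipschitz3 tau : Prop :=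
  exists2 L : R, 0 <= L &
    forall p q, mdist (tau p) (tau q) <= L * max_dist3 p q.

End comixer.

(* Main.v *)
From HB Require Import structures.
Require Import Defs.
From mathcomp Require Import all_boot all_order all_algebra all_fingroup.
From mathcomp Require Import generic_quotient.
From mathcomp Require Import all_classical all_reals all_analysis.
From mathcomp Require Import homotopy lra.
Import Order.TTheory GRing.Theory Num.Theory.
Import numFieldNormedType.Exports.
Local Open Scope classical_set_scope.
Local Open Scope ring_scope.
Set Implicit Arguments.
Unset Strict Implicit.
Unset Printing Implicit Defensive.

(** The space X consists of the subsets of the interval (0, 1], identified when
    they differ by a null set or when one is, up to a null set, the complement
    of the other. Before complements are identified, the sets modulo null sets
    form a group E of exponent 2 under symmetric difference, with the invariant
    metric len (A + B); X is the quotient of E by the subgroup of order two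
    generated by the whole interval.

    In a group of exponent 2 the map (A, B, C) |-> A + B + C satisfies the
    identities of a co-mixer, and it is 1-Lipschitz in each variable for an
    invariant metric (bis_add3_lipschitz).

    The group E is contractible, and more precisely behaves like a convex set:
    mix A B s, which equals B on (0, s] and A on (s, 1], moves continuously from
    A to B as s grows from 0 to 1. A set and its complement are at distance 1, so
    E is a two-sheeted covering of X. Thus the fundamental group of X has order
    two. Concretely, paths and homotopies in X lift to families of sets
    (lifting). Two paths whose lifts have the same ends are homotopic, by mixing
    the lifts (path_homotopic_lifts); hence a loop at the class of A is
    homotopic either to the constant loop or to the half turn, the image of the
    path mix A (~` A). A null-homotopy of the half turn would lift to a family
    of sets over the square that is A along three sides while the fourth side
    leads from A to its complement, which is absurd (half_turn_nontrivial).

    Outer measure is used as the length, so that all subsets are allowed: the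
    argument needs only monotonicity, subadditivity and the lengths of
    intervals. *)

(** * Outer length *)

Section length.
Context {R : realType}.
Implicit Types A B C : set R.

Let outer A : \bar R := ((wlength (@idfun R))^*)%mu A.

(** On the half-open interval the mixtures mix A B 0 and mix A B 1 below agree
    with A and B everywhere, not just almost everywhere. *)
Definition len A : R := fine (outer (A `&` `]0, 1])).

Let outer_itv (a b : R) : a <= b -> outer `]a, b] = (b - a)%:E.
Proof.
move=> ab; have := lebesgue_measure_itv `]a, b].
rewrite /= lte_fin -EFinB /lebesgue_measure => h.
rewrite [LHS]h; move: ab; rewrite le_eqVlt => /predU1P[->|->//].
by rewrite ltxx subrr.
Qed.

Let outer_fin A : outer (A `&` `]0, 1]) \is a fin_num.
Proof.
rewrite ge0_fin_numE; last exact: outer_measure_ge0.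
apply: (@le_lt_trans _ _ (outer `]0, 1])).
  by apply: le_outer_measure; exact: subIsetr.
by rewrite outer_itv ?ler01// ltry.
Qed.

Lemma len_ge0 A : 0 <= len A.
Proof. exact/fine_ge0/outer_measure_ge0. Qed.

Lemma le_len A B : (forall x, 0 < x <= 1 -> A x -> B x) -> len A <= len B.
Proof.
move=> AB; apply: fine_le; [exact: outer_fin..|].
apply: le_outer_measure => x [Ax x01]; split=> //.
by apply: AB => //; move: x01; rewrite /= in_itv.
Qed.

Lemma lenU A B : len (A `|` B) <= len A + len B.
Proof.
rewrite /len -fineD ?outer_fin//; apply: fine_le.
- exact: outer_fin.
- by rewrite fin_numD !outer_fin.
- by rewrite setIUl; exact: outer_measureU2.
Qed.

Lemma len0 : len set0 = 0.
Proof. by rewrite /len set0I /outer outer_measure0. Qed.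

Lemma len_null A : (forall x, 0 < x <= 1 -> ~ A x) -> len A = 0.
Proof.
move=> nA; apply/eqP; rewrite eq_le len_ge0 andbT -[leRHS]len0.
by apply: le_len => x /nA.
Qed.

Lemma lenT : len setT = 1.
Proof. by rewrite /len setTI outer_itv ?ler01//= subr0. Qed.

Lemma len_itv (a b : R) : a <= b -> len `]a, b] <= b - a.
Proof.
move=> ab; rewrite -[leRHS]/(fine (b - a)%:E) -outer_itv//.
apply: fine_le; [exact: outer_fin|by rewrite outer_itv|].
by apply: le_outer_measure; exact: subIsetl.
Qed.

End length.

(** * Sets modulo complement *)

Lemma setYCr T (A B : set T) : A `+` ~` B = ~` (A `+` B).
Proof. by rewrite -!setYTC setYA. Qed.

Section qlen.
Context {R : realType}.
Implicit Types A B C : set R.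

Definition qlen A : R := Num.min (len A) (len (~` A)).

(** Replacing A or B by its complement replaces A + B by itself or by its
    complement, so the inequality reduces to subadditivity for whichever of A, ~A
    and B, ~B are the shorter ones. *)
Lemma qlenY A B : qlen (A `+` B) <= qlen A + qlen B.
Proof.
have sub (C D E : set R) : C `<=` D `|` E -> len C <= len D + len E.
  by move=> CDE; apply: le_trans (lenU _ _); apply: le_len => x _; exact: CDE.
have h1 : len (A `+` B) <= len A + len B.
  by apply: sub => x /=; tauto.
have h2 : len (A `+` B) <= len (~` A) + len (~` B).
  by apply: sub => x /=; tauto.
have h3 : len (~` (A `+` B)) <= len (~` A) + len B.
  by apply: sub => x /=; have := EM (A x); have := EM (B x); tauto.
have h4 : len (~` (A `+` B)) <= len A + len (~` B).
  by apply: sub => x /=; have := EM (A x); have := EM (B x); tauto.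
rewrite /qlen ge_min; apply/orP.
case: (leP (len A) (len (~` A))) => _; case: (leP (len B) (len (~` B))) => _;
  [left|right|right|left]; lra.
Qed.

Lemma len_setC A : 1 <= len A + len (~` A).
Proof. by rewrite -lenT -(setUv A); exact: lenU. Qed.

Lemma len_le1 A : len A <= 1.
Proof. by rewrite -lenT; exact: le_len. Qed.

Lemma qlen_ge0 A : 0 <= qlen A.
Proof. by rewrite le_min !len_ge0. Qed.

Lemma qlen_le A : qlen A <= len A.
Proof. by rewrite ge_min lexx. Qed.

Lemma qlenC A : qlen (~` A) = qlen A.
Proof. by rewrite /qlen setCK minC. Qed.

(** A set and its complement cannot both be shorter than 1/2: this is what
    makes the projection onto the sets modulo complement a local isometry. *)
Lemma qlen_small A : len A < 2^-1 -> qlen A = len A.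
Proof. by move=> A2; apply: min_l; have := len_setC A; lra. Qed.

Lemma lenC_eq0 A : len (~` A) = 0 -> len A = 1.
Proof. by have := len_setC A; have := len_le1 A; lra. Qed.

End qlen.

Section bisection.
Local Open Scope quotient_scope.
Context (R : realType).
Implicit Types A B C : set R.

Definition bisection_rel A B : bool := qlen (A `+` B) == 0.

Let bisection_rel_refl : reflexive bisection_rel.
Proof.
by move=> A; rewrite /bisection_rel setYK eq_le qlen_ge0 -len0 qlen_le.
Qed.

Let bisection_rel_sym : symmetric bisection_rel.
Proof. by move=> A B; rewrite /bisection_rel setYC. Qed.

Lemma qlen_dist A B C : qlen (A `+` C) <= qlen (A `+` B) + qlen (B `+` C).
Proof.
rewrite [A `+` C](_ : _ = (A `+` B) `+` (B `+` C)); first exact: qlenY.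
by rewrite setYA -(setYA A B B) setYK setY0.
Qed.

Let bisection_rel_trans : transitive bisection_rel.
Proof.
move=> B A C /eqP AB /eqP BC; rewrite /bisection_rel eq_le qlen_ge0 andbT.
by apply: le_trans (qlen_dist A B C) _; rewrite AB BC addr0.
Qed.

Canonical bisection_equiv := EquivRel bisection_rel
  bisection_rel_refl bisection_rel_sym bisection_rel_trans.

Definition bisection : Type := {eq_quot bisection_equiv}.
HB.instance Definition _ := Choice.on bisection.
HB.instance Definition _ := EqQuotient.on bisection.

Definition bis A : bisection := \pi A.

Definition bis_dist (x y : bisection) : R := qlen (repr x `+` repr y).

Lemma bis_reprK (x : bisection) : bis (repr x) = x.
Proof. exact: reprK. Qed.

(** The distance does not depend on the representatives, because those of
    one class are at distance 0. *)
Lemma bis_distE A B : bis_dist (bis A) (bis B) = qlen (A `+` B).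
Proof.
have rel C : qlen (repr (bis C) `+` C) = 0.
  by apply/eqP; rewrite -/(bisection_rel _ _); apply/eqmodP; exact: reprK.
apply/eqP; rewrite eq_le /bis_dist; apply/andP; split.
  apply: le_trans (qlen_dist _ A _) _; rewrite rel add0r.
  by apply: le_trans (qlen_dist _ B _) _; rewrite (setYC B) rel addr0.
apply: le_trans (qlen_dist _ (repr (bis A)) _) _; rewrite setYC rel add0r.
by apply: le_trans (qlen_dist _ (repr (bis B)) _) _; rewrite rel addr0.
Qed.

Let bis_distxx x : bis_dist x x = 0.
Proof. by rewrite -(bis_reprK x) bis_distE; apply/eqP/bisection_rel_refl. Qed.

Let bis_dist_pos x y : bis_dist x y = 0 -> x = y.
Proof. 
rewrite -(bis_reprK x) -(bis_reprK y) bis_distE => xy.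
by apply/eqmodP/eqP.
Qed.

Let bis_dist_sym x y : bis_dist x y = bis_dist y x.
Proof. by rewrite /bis_dist setYC. Qed.

Let bis_dist_triangle y x z : bis_dist x z <= bis_dist x y + bis_dist y z.
Proof. exact: qlen_dist. Qed.

HB.instance Definition _ := isMetric.Build R bisection
  bis_distxx bis_dist_pos bis_dist_sym bis_dist_triangle.

Lemma mdist_bis A B : mdist (bis A) (bis B) = qlen (A `+` B).
Proof. exact: bis_distE. Qed.

Lemma bis_eq A B : len (A `+` B) = 0 -> bis A = bis B.
Proof.
move=> AB; apply: mdist_positivity; apply/eqP.
by rewrite mdist_bis eq_le qlen_ge0 -AB qlen_le.
Qed.

Lemma bis_setC A : bis (~` A) = bis A.
Proof.
apply: mdist_positivity; apply/eqP; rewrite mdist_bis eq_le qlen_ge0 andbT.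
by rewrite setCYT -setC0 qlenC -len0 qlen_le.
Qed.

(** The fibre of the projection has two points. *)
Lemma bis_eqP A B :
  bis A = bis B -> len (A `+` B) = 0 \/ len (A `+` ~` B) = 0.
Proof.
move=> AB; have : qlen (A `+` B) = 0 by rewrite -mdist_bis AB mdistxx.
by rewrite setYCr /qlen; case: leP => _; [left|right].
Qed.

End bisection.

(** * The co-mixer *)

Section metric_continuity.
Context {R : realType}.

Lemma metric_continuousP (T : topologicalType) (X : metricType R) (f : T -> X) :
  continuous f <->
  forall z e, 0 < e -> \forall z' \near z, mdist (f z) (f z') < e.
Proof.
split=> [cf z e e0|cf z].
  have ze : nbhs z (f @^-1` ball (f z) e) := cf z _ (nbhsx_ballx _ _ e0).
  by apply: filterS ze => z'; rewrite /= ballEmdist.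
apply/cvg_ballP => e e0; rewrite ballEmdist.
exact: cf.
Qed.

Lemma lipschitz3_continuous (X : metricType R) (tau : X * X * X -> X) :
  is_lipschitz3 tau -> continuous tau.
Proof.
move=> [L L0 lip]; apply/metric_continuousP => p e e0.
have L1 : 0 < L + 1 by lra.
have d0 : 0 < e / (L + 1) by rewrite divr_gt0.
have := nbhsx_ballx p _ d0; apply: filterS => q [[]].
rewrite !ballEmdist/= => h1 h2 h3.
apply: le_lt_trans (lip p q) _.
have : max_dist3 p q < e / (L + 1) by rewrite /max_dist3 !gt_max h1 h2 h3.
rewrite ltr_pdivlMr// => h; have : 0 <= max_dist3 p q.
  by rewrite le_max mdist_ge0.
nra.
Qed.

End metric_continuity.

Section symmetric_difference_comixer.
Context {R : realType}.
Local Notation X := (bisection R).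

Definition bis_add3 (p : X * X * X) : X :=
  bis (repr p.1.1 `+` repr p.1.2 `+` repr p.2).

Lemma bis_add3_lipschitz : is_lipschitz3 bis_add3.
Proof.
exists 3 => // -[[a b] c] [[a' b'] c']; rewrite mdist_bis /max_dist3 /=.
rewrite [X in qlen X](_ : _ = (repr a `+` repr a') `+` (repr b `+` repr b')
   `+` (repr c `+` repr c'));
  last by rewrite (Monoid.mulmACA setY) (Monoid.mulmACA setY (repr a)).
set m := Num.max _ _.
have ma : mdist a a' <= m by rewrite le_max lexx.
have mb : mdist b b' <= m by rewrite !le_max lexx orbT.
have mc : mdist c c' <= m by rewrite !le_max lexx !orbT.
apply: le_trans (qlenY _ _) _.
have := qlenY (repr a `+` repr a') (repr b `+` repr b').
move: ma mb mc; rewrite /mdist/=/bis_dist. lra.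
Qed.

Lemma bis_add3_comixer : is_comixer bis_add3.
Proof.
split; first exact: lipschitz3_continuous bis_add3_lipschitz.
move=> a b; rewrite /bis_add3/=; split.
- by rewrite setYK set0Y bis_reprK.
- by rewrite setYC setYA setYK set0Y bis_reprK.
- by rewrite -setYA setYK setY0 bis_reprK.
Qed.
End symmetric_difference_comixer.

(** * Continuous families of sets *)

Section families.
Context {R : realType}.
Local Notation X := (bisection R).
Implicit Types A B : set R.

Lemma len_dist A B C : len (A `+` C) <= len (A `+` B) + len (B `+` C).
Proof.
apply: le_trans (lenU _ _); apply: le_len => x _ /=.
by have := EM (B x); tauto.
Qed.

Lemma len_eq0_trans A B C :
  len (A `+` B) = 0 -> len (B `+` C) = 0 -> len (A `+` C) = 0.
Proof.
move=> AB BC; apply/eqP; rewrite eq_le len_ge0 andbT.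
by apply: le_trans (len_dist _ B _) _; rewrite AB BC addr0.
Qed.

(** Continuity for the pseudometric len (A `+` B), under which null sets are
    not identified. *)
Definition len_continuous (T : topologicalType) (P : T -> set R) :=
  forall z e, 0 < e -> \forall z' \near z, len (P z `+` P z') < e.

Lemma bis_continuous (T : topologicalType) (P : T -> set R) :
  len_continuous P -> continuous (fun z => bis (P z)).
Proof.
move=> cP; apply/metric_continuousP => z e e0.
apply: filterS (cP z e e0) => z'; rewrite mdist_bis; apply: le_lt_trans.
exact: qlen_le.
Qed.

Lemma len_continuous_cst (T : topologicalType) A :
  len_continuous (fun _ : T => A).
Proof.
by move=> z e e0; near=> z'; rewrite setYK len0.
Unshelve. all: end_near. Qed.

Lemma len_continuous_comp (S T : topologicalType) (f : S -> T) (P : T -> set R) :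
  continuous f -> len_continuous P -> len_continuous (fun s => P (f s)).
Proof. by move=> cf cP z e e0; exact: cf (cP (f z) e e0). Qed.

Lemma len_continuous_dist (T : topologicalType) (P Q : T -> set R) :
  len_continuous P -> len_continuous Q ->
  continuous (fun z => len (P z `+` Q z)).
Proof.
move=> cP cQ z; apply/cvgrPdist_lt => e e0.
have e2 : 0 < e / 2 by rewrite divr_gt0.
move: (cP z _ e2) (cQ z _ e2); apply: filterS2 => z' Pz Qz.
have := len_dist (P z) (P z') (Q z); have := len_dist (P z') (Q z') (Q z).
have := len_dist (P z') (P z) (Q z'); have := len_dist (P z) (Q z) (Q z').
rewrite (setYC (P z') (P z)) (setYC (Q z') (Q z)) => *.
by rewrite ltr_norml; apply/andP; split; lra.
Qed.

Definition mix A B (s : R) : set R :=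
  [set x | (s < x /\ A x) \/ (x <= s /\ B x)].

Lemma mix0 A B : len (mix A B 0 `+` A) = 0.
Proof.
apply: len_null => x /andP[x0 _].
by rewrite /mix/= (leNgt x) x0/=; have := isT; have := notF; tauto.
Qed.

Lemma mix1 A B : len (mix A B 1 `+` B) = 0.
Proof.
apply: len_null => x /andP[_ x1].
by rewrite /mix/= (ltNge 1) x1/=; have := isT; have := notF; tauto.
Qed.

(** Apart from the places where A differs from A' or B from B', the two mixtures
    differ only between the cuts s and s'. *)
Lemma mix_dist A A' B B' s s' :
  len (mix A B s `+` mix A' B' s') <=
  len (A `+` A') + len (B `+` B') + `|s - s'|.
Proof.
wlog ss' : A A' B B' s s' / s <= s'.
  move=> h; have [ss'|/ltW s's] := leP s s'; first exact: h.
  by rewrite (setYC (mix A B s)) (setYC A) (setYC B) distrC; exact: h.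
rewrite distrC ger0_norm ?subr_ge0//.
apply: le_trans (lerD (lexx _) (len_itv ss')).
apply: le_trans (lerD (lenU _ _) (lexx _)).
apply: le_trans (lenU _ _).
apply: le_len => x _; rewrite /mix /setY /= in_itv/=.
case: (ltP s x) => sx; case: (leP x s') => xs' /=;
  try by have := isT; have := notF; tauto.
by have := lt_le_trans xs' (le_trans sx ss'); rewrite ltxx.
Qed.

Lemma len_continuous_mix (T : topologicalType) (P Q : T -> set R) (s : T -> R) :
  len_continuous P -> len_continuous Q -> continuous s ->
  len_continuous (fun z => mix (P z) (Q z) (s z)).
Proof.
move=> cP cQ cs z e e0.
have e3 : 0 < e / 3 by rewrite divr_gt0.
have /cvgrPdist_lt/(_ _ e3) ce := cs z.
move: (cP z _ e3) (cQ z _ e3) ce; apply: filterS3 => z' Pz Qz sz.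
by apply: le_lt_trans (mix_dist _ _ _ _ _ _) _; lra.
Qed.

(** Uniqueness of lifts: the distance between two lifts of one path takes
    only the values 0 and 1, and is continuous. *)
Lemma lift_endpoint (P Q : unit_interval R -> set R) :
  len_continuous P -> len_continuous Q ->
  (forall t, bis (P t) = bis (Q t)) ->
  len (P zero `+` Q zero) = 0 -> len (P one `+` Q one) = 0.
Proof.
move=> cP cQ PQ PQ0; have [//|PQ1] := bis_eqP (PQ one).
have cf := comp_continuous clamp_continuous (len_continuous_dist cP cQ).
have [|c _ fc] := @IVT _ _ 0 1 2^-1 ler01 (continuous_subspaceT cf).
  rewrite -[clamp 0]/zero -[clamp 1]/one PQ0 (lenC_eq0 _) -?setYCr//.
  by rewrite ge_min le_max; apply/andP; split; apply/orP; [left|right]; lra.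
have := bis_eqP (PQ (clamp c)); rewrite setYCr => -[|/lenC_eq0]; lra.
Qed.

End families.

Section connectedness.
Context {R : realType}.

(** Every class is joined to that of the empty set by the mixtures of the two. *)
Lemma bisection_connected : connected [set: bisection R].
Proof.
pose rays (A : set R) : set (bisection R) :=
  range (fun t : R => bis (mix set0 A t)).
rewrite (_ : setT = \bigcup_(A in setT) rays A); last first.
  apply/seteqP; split=> // x _; exists (repr x) => //; exists 1 => //.
  by rewrite (bis_eq (mix1 _ _)) bis_reprK.
apply: bigcup_connected.
  by exists (bis set0) => A _; exists 0 => //; rewrite (bis_eq (mix0 _ _)).
move=> A _; apply: connected_continuous_connected.
  by apply/connected_intervalP => x y z.
apply: continuous_subspaceT; apply: bis_continuous; apply: len_continuous_mix.
- exact: len_continuous_cst.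
- exact: len_continuous_cst.
- exact: fun_id_continuous.
Qed.

End connectedness.

(** * Lifting paths and homotopies *)

Section lifting.
Context {R : realType}.
Local Notation X := (bisection R).

(** The Heine-Cantor theorem; z' may lie outside of K. *)
Lemma compact_uniform (V : pseudoMetricType R) (Y : metricType R) (K : set V)
    (F : V -> Y) (e : R) : compact K -> continuous F -> 0 < e ->
  exists2 d : R, 0 < d &
    forall z z', K z -> ball z d z' -> mdist (F z) (F z') < e.
Proof.
move=> /compact_near_coveringP cK /metric_continuousP cF e0.
have e2 : 0 < e / 2 by rewrite divr_gt0.
pose good (d : R) (z : V) := forall z', ball z d z' -> mdist (F z) (F z') < e.
have : \forall d \near 0^'+, K `<=` good d.
  apply: cK => z Kz.
  have /nbhs_ballP[r r0 zr] := cF z _ e2.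
  have r2 : 0 < r / 2 by rewrite divr_gt0.
  exists (ball z (r / 2), [set d : R | d < r / 2]).
    by split; [exact: nbhsx_ballx|exact: nbhs_right_lt].
  move=> [w d] [/= zw dr] w' ww'.
  have wz : mdist (F z) (F w) < e / 2.
    by apply: zr; apply: le_ball zw; lra.
  have wz' : mdist (F z) (F w') < e / 2.
    apply: zr; rewrite (splitr r); apply: ball_triangle zw _.
    by apply: le_ball ww'; exact: ltW.
  apply: le_lt_trans (metric_triangle _ (F z) _) _.
  by rewrite metric_sym; lra.
move=> good_near.
have [d [Kd d0]] : exists d, K `<=` good d /\ 0 < d.
  near (0 : R)^'+ => d; exists d; split; near: d => //; exact: nbhs_right_gt.
by exists d => // z z' /Kd; exact.
Unshelve. all: end_near. Qed.

(** Of the two representatives of the class x, the one closer to A. *)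
Definition nearest (A : set R) (x : X) : set R :=
  if len (A `+` repr x) <= len (~` (A `+` repr x)) then repr x else ~` repr x.

Lemma bis_nearest A x : bis (nearest A x) = x.
Proof. by rewrite /nearest; case: ifP => _; rewrite ?bis_setC bis_reprK. Qed.

Lemma len_nearest A x : len (A `+` nearest A x) = mdist (bis A) x.
Proof.
rewrite -{2}(bis_reprK x) mdist_bis /nearest /qlen.
by case: leP => // _; rewrite setYCr.
Qed.

(** Cut the segment from 0 to z into n.+1 equal steps, so short that F moves by
    less than 1/8 along each, and follow F from one cut point to the next, always
    taking the representative nearest to the previous one. If z and z' are close,
    then at each step the two chosen representatives are within 3/8 < 1/2 of
    each other, hence at the same distance as their classes. *)
Lemma lifting (V : normedModType R) (K : set V) (F : V -> X) (A : set R) :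
  compact K -> (forall z t, K z -> 0 <= t <= 1 -> K (t *: z)) ->
  continuous F -> bis A = F 0 ->
  exists L : V -> set R, [/\ len (A `+` L 0) = 0,
    forall z, K z -> bis (L z) = F z
    & exists2 d, 0 < d & forall z z', K z -> K z' -> `|z - z'| < d ->
        len (L z `+` L z') = mdist (F z) (F z')].
Proof.
move=> cK starK cF AF0.
have e0 : 0 < 8^-1 :> R by lra.
have [d d0 Fd] := compact_uniform cK cF e0.
have [M KM] : exists M, forall z, K z -> `|z| <= M.
  have [M0 [_ KM0]] := compact_bounded cK.
  by exists (M0 + 1); apply: KM0; rewrite ltrDl.
have [n Mn] : exists n : nat, M < n.+1%:R * d.
  by exists (Num.truncn (M / d)); rewrite -ltr_pdivrMr// truncnS_gt.
(* L k z is the representative chosen at the k-th cut point. *)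
pose r (k : nat) : R := k%:R / n.+1%:R.
have r01 k : (k <= n.+1)%N -> 0 <= r k <= 1.
  move=> kn; rewrite divr_ge0//= ler_pdivrMr// mul1r ler_nat//.
pose L := fix L k z := if k is k'.+1 then nearest (L k' z) (F (r k *: z)) else A.
have bL k z : bis (L k z) = F (r k *: z).
  case: k => [|k] /=; last exact: bis_nearest.
  by rewrite AF0 /r mul0r scale0r.
have step k z : K z -> (k < n.+1)%N -> len (L k z `+` L k.+1 z) < 8^-1.
  move=> Kz kn; rewrite /= len_nearest bL; apply: Fd.
    by apply: starK => //; apply: r01; exact: ltnW.
  rewrite -ball_normE /= -scalerBl normrZ distrC /r -mulrBl -natrB ?leqnSn//.
  rewrite subSnn mul1r ger0_norm ?invr_ge0// mulrC ltr_pdivrMr// mulrC.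
  exact: le_lt_trans (KM z Kz) Mn.
have close k z z' : K z -> K z' -> (k <= n.+1)%N -> `|z - z'| < d ->
    len (L k z `+` L k z') = mdist (F (r k *: z)) (F (r k *: z')).
  move=> Kz Kz' + zz'; elim: k => [_|k IH kn].
    by rewrite /= setYK len0 /r mul0r !scale0r mdistxx.
  rewrite -!bL mdist_bis qlen_small//.
  have {}IH : len (L k z `+` L k z') < 8^-1.
    rewrite IH; last exact: ltnW.
    have /andP[r0 r1] := r01 k (ltnW kn).
    apply: Fd; first by apply: starK => //; rewrite r0.
    rewrite -ball_normE /= -scalerBr normrZ ger0_norm//.
    by apply: le_lt_trans zz'; rewrite ler_piMl.
  have := len_dist (L k.+1 z) (L k z) (L k.+1 z').
  have := len_dist (L k z) (L k z') (L k.+1 z').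
  have := step k z Kz kn; have := step k z' Kz' kn.
  rewrite (setYC (L k.+1 z) (L k z)); lra.
have rn : r n.+1 = 1 by rewrite /r divff.
exists (L n.+1); split.
- elim: n.+1 => [|k IH]; first by rewrite /= setYK len0.
  by apply: len_eq0_trans IH _; rewrite /= len_nearest bL !scaler0 mdistxx.
- by move=> z _; rewrite bL rn scale1r.
- by exists d => // z z' Kz Kz' zz'; rewrite close// rn !scale1r.
Qed.

(** Transport of the lifting to a space T that is homeomorphic, through u, to a
    compact starshaped set; c retracts V onto T, so that F extends to V. *)
Lemma lifting_retract (T : topologicalType) (V : normedModType R)
    (u : T -> V) (c : V -> T) (t0 : T) (F : T -> X) (A : set R) :
  continuous u -> continuous c -> cancel u c -> u t0 = 0 ->
  compact (range u) ->
  (forall t k, 0 <= k <= 1 -> range u (k *: u t)) ->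
  continuous F -> bis A = F t0 ->
  exists L : T -> set R, [/\ len_continuous L, forall t, bis (L t) = F t
    & len (A `+` L t0) = 0].
Proof.
move=> cu cc uK u0 cK starK cF AF.
have [||||L [AL LF [d d0 Ld]]] := @lifting V (range u) (F \o c) A.
- by [].
- by move=> _ k [t _ <-]; exact: starK.
- exact: comp_continuous cc cF.
- by rewrite AF -(uK t0) u0.
exists (L \o u); split => [t e e0|t|].
- have /cvgrPdist_lt/(_ _ d0) ut := cu t.
  have /metric_continuousP/(_ t e e0) Ft := cF.
  move: ut Ft; apply: filterS2 => t' ut Ft.
  by rewrite /= Ld//=; [rewrite !uK|exists t|exists t'].
- by rewrite /= LF/=; [rewrite uK|exists t].
- by rewrite /= u0.
Qed.

Lemma lifting_path (p : unit_interval R -> X) (A : set R) :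
  continuous p -> bis A = p zero ->
  exists P : unit_interval R -> set R, [/\ len_continuous P,
    forall t, bis (P t) = p t & len (A `+` P zero) = 0].
Proof.
apply: (@lifting_retract _ R uval clamp zero).
- exact: val_continuous.
- exact: clamp_continuous.
- exact: clampK.
- exact: val_zero.
- suff -> : range (@uval R) = `[0, 1]%classic by exact: segment_compact.
  apply/seteqP; split=> [_ [t _ <-]|x /=]; rewrite /= in_itv/=.
    exact: unit_interval_itv.
  by move=> x01; exists (clamp x) => //; rewrite clampE.
- move=> t k /andP[k0 k1]; exists (clamp (k * uval t)) => //; rewrite clampE//.
  have /andP[t0 t1] := unit_interval_itv t.
  by rewrite mulr_ge0//= mulr_ile1.
Qed.

Lemma lifting_square (H : unit_interval R * unit_interval R -> X) (A : set R) :
  continuous H -> bis A = H (zero, zero) ->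
  exists P : unit_interval R * unit_interval R -> set R, [/\ len_continuous P,
    forall t, bis (P t) = H t & len (A `+` P (zero, zero)) = 0].
Proof.
apply: (@lifting_retract _ (R * R)%type (fun t => (uval t.1, uval t.2))
  (fun z => (clamp z.1, clamp z.2)) (zero, zero)).
- cts.
- cts.
- by move=> [s t] /=; rewrite !clampK.
- by rewrite /= val_zero.
- suff -> : range (fun t => (uval t.1, uval t.2)) =
      (`[0 : R, 1]%classic `*` `[0 : R, 1]%classic).
    by apply: compact_setX; exact: segment_compact.
  apply/seteqP; split=> [_ [t _ <-]|[x y] /=]; rewrite /= !in_itv/=.
    by split; exact: unit_interval_itv.
  by move=> [x01 y01]; exists (clamp x, clamp y) => //=; rewrite !clampE.
- move=> [s t] k /andP[k0 k1].
  exists (clamp (k * uval s), clamp (k * uval t)) => //=.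
  have /andP[s0 s1] := unit_interval_itv s.
  have /andP[t0 t1] := unit_interval_itv t.
  by rewrite !clampE// mulr_ge0//= mulr_ile1.
Qed.

End lifting.

(** * The fundamental group *)

Section fundamental_group_bisection.
Context {R : realType}.
Local Notation X := (bisection R).
Local Notation I := (unit_interval R).
Implicit Types A B : set R.

(** The homotopy mixes the lifts; at the common ends mixing changes nothing. *)
Lemma path_homotopic_lifts (x y : X) (p q : {path I from x to y in X})
    (P Q : I -> set R) :
  len_continuous P -> len_continuous Q ->
  (forall t, bis (P t) = p t) -> (forall t, bis (Q t) = q t) ->
  len (P zero `+` Q zero) = 0 -> len (P one `+` Q one) = 0 ->
  path_homotopic p q.
Proof.
move=> cP cQ Pp Qq PQ0 PQ1.
have mixP A B s : len (A `+` B) = 0 -> bis (mix A B s) = bis A.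
  move=> AB; apply: bis_eq; apply/eqP; rewrite eq_le len_ge0 andbT -[leRHS]AB.
  apply: le_len => r _; rewrite /mix/=.
  case: (ltP s r) => _; have := isT; have := notF; tauto.
exists (fun st => bis (mix (P st.2) (Q st.2) (uval st.1))).
split=> [|t|t|s|s] /=.
- apply: bis_continuous; apply: len_continuous_mix; last by cts.
    by apply: (len_continuous_comp _ cP); cts.
  by apply: (len_continuous_comp _ cQ); cts.
- by rewrite val_zero (bis_eq (mix0 _ _)) Pp.
- by rewrite val_one (bis_eq (mix1 _ _)) Qq.
- by rewrite mixP// Pp path_zero.
- by rewrite mixP// Pp path_one.
Qed.

Section half_turn.
Variable A : set R.

Definition half_turn_lift (t : I) : set R := mix A (~` A) (uval t).

Lemma half_turn_lift_continuous : len_continuous half_turn_lift.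
Proof.
apply: len_continuous_mix; last exact: val_continuous.
- exact: len_continuous_cst.
- exact: len_continuous_cst.
Qed.

Lemma half_turn_lift0 : len (half_turn_lift zero `+` A) = 0.
Proof. by rewrite /half_turn_lift val_zero mix0. Qed.

Lemma half_turn_lift1 : len (half_turn_lift one `+` ~` A) = 0.
Proof. by rewrite /half_turn_lift val_one mix1. Qed.

Let half_turn_zero : bis (half_turn_lift zero) = bis A.
Proof. exact: bis_eq half_turn_lift0. Qed.

Let half_turn_one : bis (half_turn_lift one) = bis A.
Proof. by rewrite (bis_eq half_turn_lift1) bis_setC. Qed.

Definition half_turn : {path I from bis A to bis A in X} :=
  mk_path (bis_continuous half_turn_lift_continuous)
    half_turn_zero half_turn_one.

(** A lift starting at A ends at A or at its complement. *)
Lemma loop_cst_or_half_turn (p : {path I from bis A to bis A in X}) :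
  path_homotopic p (path_cst (bis A)) \/ path_homotopic p half_turn.
Proof.
have cp : continuous p := @cts_fun _ _ p.
have [|P [cP Pp AP0]] := lifting_path (A := A) cp.
  by rewrite path_zero.
have P0A : len (P zero `+` A) = 0 by rewrite setYC.
have := Pp one; rewrite path_one => /bis_eqP[P1|P1].
- left; apply: (path_homotopic_lifts (P := P) (Q := fun=> A)) => //.
  exact: len_continuous_cst.
- right; apply: (path_homotopic_lifts (P := P) (Q := half_turn_lift)) => //.
  + exact: half_turn_lift_continuous.
  + by apply: len_eq0_trans P0A _; rewrite setYC half_turn_lift0.
  + by apply: len_eq0_trans P1 _; rewrite setYC half_turn_lift1.
Qed.

(** The corners of a lifted null-homotopy are, on the side of the half turn, A
    and ~A; the other three sides are constant in the quotient, so that the lift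
    is constant along them and both values reach the same opposite corner. *)
Lemma half_turn_nontrivial : ~ path_homotopic half_turn (path_cst (bis A)).
Proof.
move=> [H [cH H0 H1 Hl Hr]].
have [|L [cL LH AL]] := lifting_square (A := A) cH.
  by rewrite H0 path_zero.
have cst B : len_continuous (fun _ : I => B) := len_continuous_cst B.
have side (f : I -> I * I) : continuous f -> len_continuous (L \o f).
  by move=> cf; exact: (len_continuous_comp cf cL).
have L00 : len (L (zero, zero) `+` A) = 0 by rewrite setYC.
have L01 : len (L (zero, one) `+` ~` A) = 0.
  apply: (len_eq0_trans (B := half_turn_lift one)) half_turn_lift1.
  apply: (lift_endpoint (P := fun t => L (zero, t))).
  - by apply: (side (fun t => (zero, t))); cts.
  - exact: half_turn_lift_continuous.
  - by move=> t; rewrite LH H0.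
  - by apply: len_eq0_trans L00 _; rewrite setYC half_turn_lift0.
have L10 : len (L (one, zero) `+` A) = 0.
  apply: (lift_endpoint (P := fun s => L (s, zero)) (Q := fun=> A)) => //.
  - by apply: (side (fun s => (s, zero))); cts.
  - by move=> s; rewrite LH Hl.
have L11 : len (L (one, one) `+` A) = 0.
  apply: (lift_endpoint (P := fun t => L (one, t)) (Q := fun=> A)) => //.
  - by apply: (side (fun t => (one, t))); cts.
  - by move=> t; rewrite LH H1.
have L11' : len (L (one, one) `+` ~` A) = 0.
  apply: (lift_endpoint (P := fun s => L (s, one)) (Q := fun=> ~` A)) => //.
  - by apply: (side (fun s => (s, one))); cts.
  - by move=> s; rewrite LH Hr bis_setC.
have : len (A `+` ~` A) = 0 by apply: len_eq0_trans L11'; rewrite setYC.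
by rewrite setYCT lenT => /eqP; rewrite oner_eq0.
Qed.

End half_turn.
End fundamental_group_bisection.

Lemma group_of_order2 (G : groupType) (g : G) :
  g <> 1%g -> (forall a : G, a = 1%g \/ a = g) -> group_isomorphic G 'Z_2.
Proof.
move=> g1 Gg.
have gg : (g * g = 1)%g.
  by have [//|/(congr1 (mulg g^-1))] := Gg (g * g)%g; rewrite mulKg mulVg.
pose f (a : G) : 'Z_2 := if a == 1%g then 0 else 1.
have g1F : (g == 1%g) = false by apply/eqP.
have f1 : f 1%g = 0 by rewrite /f eqxx.
have fg : f g = 1 by rewrite /f g1F.
exists f; split.
  exists (fun z : 'Z_2 => if z == 0 then 1%g else g).
  - by move=> a; have [->|->] := Gg a; rewrite ?f1 ?fg.
  - move=> z; case: eqVneq => [->//|]; case: z => -[|[|//]] i //= _.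
    by rewrite fg; apply: val_inj.
move=> a b; rewrite Z2_mulgE.
by have [->|->] := Gg a; have [->|->] := Gg b;
  rewrite ?mul1g ?mulg1 ?gg ?f1 ?fg ?addr0 ?add0r//; apply: val_inj.
Qed.

Theorem proposition2p2 (R : realType) :
  exists X : metricType R,
    [/\ [set: X] !=set0,
        connected [set: X],
        (exists tau : X * X * X -> X, is_comixer tau /\ is_lipschitz3 tau)
      & forall x0 : X, group_isomorphic (pi1 R x0) 'Z_2].
Proof.
exists (bisection R); split.
- by exists (bis set0).
- exact: bisection_connected.
- by exists bis_add3; split; [exact: bis_add3_comixer|exact: bis_add3_lipschitz].
move=> x0; rewrite -(bis_reprK x0); set A := repr x0.
apply: (group_of_order2 (g := pi1_class (half_turn A))).
  by move=> /pi1_classP; exact: half_turn_nontrivial.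
move=> a; rewrite -(pi1_classK a).
by have [?|?] := loop_cst_or_half_turn (repr a); [left|right]; apply/pi1_classP.
Qed.
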